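(* Let $\mathbb{F}$ be a field of characteristic not $2$, let $\mathcal{U}$ be a nonzero finite-dimensional $\mathbb{F}$-vector space with $\dim_{\mathbb{F}}\mathcal{U}=n$, let $b:\mathcal{U}\times\mathcal{U}\to\mathbb{F}$ be a nondegenerate symmetric bilinear form, and let $f,g:\mathcal{U}\to\mathcal{U}$ be two commuting, diagonalizable endomorphisms that are symmetric relative to $b$ (i.e. $b(f(u),v)=b(u,f(v))$ and $b(g(u),v)=b(u,g(v))$ for all $u,v$). Let $\mathcal{E}(\mathcal{U},b,f,g)=\mathcal{U}\times\mathbb{F}\times\mathbb{F}\times\mathbb{F}$ be the algebra with multiplication $$(u,\alpha,\beta,\gamma)(v,\epsilon,\delta,\eta)=(0,\,b(u,v),\,b(f(u),v)+\alpha\epsilon,\,b(g(u),v)+\beta\delta)$$ for $u,v\in\mathcal{U}$, $\alpha,\beta,\gamma,\epsilon,\delta,\eta\in\mathbb{F}$. Then $\mathcal{E}(\mathcal{U},b,f,g)$ is a nilpotent evolution algebra of type $[1,1,1,n]$.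
   Context: An evolution algebra (finite-dimensional here) is an algebra $\mathcal{E}$ over $\mathbb{F}$ with a basis $\{e_1,\ldots,e_m\}$ (a natural basis) such that $e_je_k=0$ for $j\neq k$. For an algebra $\mathcal{A}$, $\mathrm{ann}(\mathcal{A})=\{x\in\mathcal{A}: x\mathcal{A}=\mathcal{A}x=0\}$, $\mathrm{ann}^0(\mathcal{A})=0$, and $\mathrm{ann}^i(\mathcal{A})$ is defined by $\mathrm{ann}^i(\mathcal{A})/\mathrm{ann}^{i-1}(\mathcal{A})=\mathrm{ann}(\mathcal{A}/\mathrm{ann}^{i-1}(\mathcal{A}))$. With $\mathcal{A}^1=\mathcal{A}$ and $\mathcal{A}^{k+1}=\sum_{j=1}^k\mathcal{A}^j\mathcal{A}^{k+1-j}$, $\mathcal{A}$ is nilpotent if $\mathcal{A}^m=0$ for some $m$, equivalently $\mathrm{ann}^r(\mathcal{A})=\mathcal{A}$ for some $r$. The type of a finite-dimensional nilpotent algebra $\mathcal{A}$ is the sequence $[n_1,\ldots,n_r]$, where $r$ is the least natural number with $\mathrm{ann}^r(\mathcal{A})=\mathcal{A}$ and $n_i=\dim\mathrm{ann}^i(\mathcal{A})-\dim\mathrm{ann}^{i-1}(\mathcal{A})$. *)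

(* Defs.v *)
From HB Require Import structures.
From mathcomp Require Export all_boot all_order all_algebra.

Set Implicit Arguments.
Unset Strict Implicit.
Unset Printing Implicit Defensive.

Import GRing.Theory.
Local Open Scope ring_scope.

(* A finite-dimensional, not necessarily associative, algebra is a vectType A
   together with a bilinear multiplication mul : {bilinear A -> A -> A}. *)

Section Annihilator.
Variables (F : fieldType) (A : vectType F) (mul : {bilinear A -> A -> A}).

Definition ann : {vspace A} :=
  (lker (linfun (fun x => linfun (mul x))) :&:
   lker (linfun (fun x => linfun (mul^~ x))))%VS.

Lemma annP x :
  reflect (forall y, mul x y = 0 /\ mul y x = 0) (x \in ann).
Proof.
pose lmul x := linfun (mul x); pose rmul x := linfun (mul^~ x).
have linl : linear lmul.
  move=> a u v; apply/lfunP => y.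
  by rewrite add_lfunE scale_lfunE !lfunE /= (linearPl mul y).
have linr : linear rmul.
  move=> a u v; apply/lfunP => y.
  by rewrite add_lfunE scale_lfunE !(lfunE (applyr mul _)) /= (linearPr mul y).
pose Lm := GRing.isLinear.Build _ _ _ _ lmul linl.
pose Rm := GRing.isLinear.Build _ _ _ _ rmul linr.
pose L : {linear _ -> _} := HB.pack lmul Lm.
pose R : {linear _ -> _} := HB.pack rmul Rm.
rewrite memv_cap !memv_ker (lfunE L) (lfunE R) /=.
apply: (iffP andP) => [[/eqP/lfunP l0 /eqP/lfunP r0] y | xy0].
  have := l0 y; have := r0 y.
  by rewrite !zero_lfunE (lfunE (applyr mul _)) lfunE.
split; apply/eqP/lfunP => y; rewrite zero_lfunE.
  by rewrite lfunE; have [] := xy0 y.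
by rewrite (lfunE (applyr mul _)); have [] := xy0 y.
Qed.

End Annihilator.

Section Quotient.
Variables (F : fieldType) (A : vectType F) (mul : {bilinear A -> A -> A}).
Variable I : {vspace A}.

(* The quotient space A / I is realised on the complement I^C of I, the
   canonical surjection being the projection onto I^C along I.  When I is a
   two-sided ideal, quot_mul is the multiplication of A / I. *)
Definition quot : vectType F := subvs_of I^C.

Definition quot_pi : 'Hom(A, quot) :=
  linfun (vsproj I^C \o daddv_pi I^C I).

Definition quot_mul (x y : quot) : quot := quot_pi (mul (vsval x) (vsval y)).

Fact quot_mul_bilinear : bilinear_for
  (GRing.Scale.Law.clone _ _ *:%R _) (GRing.Scale.Law.clone _ _ *:%R _) quot_mul.
Proof.
split=> [y|x] a u v; rewrite /quot_mul (linearP vsval).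
  by rewrite (linearPl mul) (linearP (quot_pi)).
by rewrite (linearPr mul) (linearP (quot_pi)).
Qed.

HB.instance Definition _ :=
  bilinear_isBilinear.Build F quot quot quot _ _ quot_mul quot_mul_bilinear.

Let capCI : (I^C :&: I)%VS = 0%VS. Proof. by rewrite capvC capv_compl. Qed.

Lemma val_quot_pi x : vsval (quot_pi x) = daddv_pi I^C I x.
Proof. by rewrite lfunE /= vsprojK ?memv_pi. Qed.

Lemma quot_piK : cancel (vsval : quot -> A) quot_pi.
Proof.
by move=> x; apply: val_inj; rewrite /= val_quot_pi daddv_pi_id // subvsP.
Qed.

Lemma quot_pi_sub x : x - vsval (quot_pi x) \in I.
Proof.
have xIC : x \in (I^C + I)%VS by rewrite addvC addv_complf memvf.
rewrite val_quot_pi -[X in X - _](daddv_pi_add capCI xIC).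
by rewrite addrAC subrr add0r memv_pi.
Qed.

Lemma lker_quot_pi : lker quot_pi = I.
Proof.
apply/vspaceP => x; rewrite memv_ker; apply/eqP/idP => [x0|xI].
  by have := quot_pi_sub x; rewrite x0 (linear0 vsval) subr0.
apply: val_inj; apply/eqP; rewrite /= -memv0 -capCI memv_cap subvsP.
by rewrite -(rpredBr _ xI) -opprB rpredN quot_pi_sub.
Qed.

Lemma quot_piM :
  (forall x y, x \in I -> mul x y \in I /\ mul y x \in I) ->
  {morph quot_pi : x y / mul x y >-> quot_mul x y}.
Proof.
move=> idI x y; apply/eqP; rewrite -subr_eq0 /quot_mul -linearB -memv_ker.
rewrite lker_quot_pi.
set x' := vsval (quot_pi x); set y' := vsval (quot_pi y).
have -> : mul x y - mul x' y' = mul (x - x') y + mul x' (y - y').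
  by rewrite linearBl linearBr addrA subrK.
by rewrite rpredD //;
  [have [] := idI _ y (quot_pi_sub x) | have [] := idI _ x' (quot_pi_sub y)].
Qed.

End Quotient.

Arguments quot_mul {F A} mul I.

Section Series.
Variables (F : fieldType) (A : vectType F) (mul : {bilinear A -> A -> A}).

Fixpoint ann_series (i : nat) : {vspace A} :=
  if i is j.+1 then
    let I := ann_series j in (quot_pi I @^-1: ann (quot_mul mul I))%VS
  else 0%VS.

Lemma ann_series_ideal i x y : x \in ann_series i ->
  mul x y \in ann_series i /\ mul y x \in ann_series i.
Proof.
elim: i x y => [|i IHi] x y /=.
  by rewrite memv0 => /eqP->; rewrite linear0l linear0r mem0v.
rewrite -!memv_preim => /annP/(_ (quot_pi _ y)) /= [xy0 yx0].
by rewrite !(quot_piM IHi) xy0 yx0 mem0v.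
Qed.

Lemma ann_seriesSP i x :
  reflect (forall y, mul x y \in ann_series i /\ mul y x \in ann_series i)
          (x \in ann_series i.+1).
Proof.
have piM := quot_piM (@ann_series_ideal i).
have inE z : (z \in ann_series i) = (quot_pi (ann_series i) z == 0).
  by rewrite -memv_ker lker_quot_pi.
rewrite /= -memv_preim; apply: (iffP (annP _ _)) => xA y.
  by have [/= xy0 yx0] := xA (quot_pi _ y); rewrite !inE !piM xy0 yx0.
have [/=] := xA (vsval y); rewrite !inE !piM quot_piK.
by move=> /eqP xy0 /eqP yx0.
Qed.

Lemma ann_seriesS i : (ann_series i <= ann_series i.+1)%VS.
Proof. by apply/subvP => x xi; apply/ann_seriesSP => y; apply: ann_series_ideal. Qed.

Definition mulv (V W : {vspace A}) : {vspace A} :=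
  <<[seq mul v w | v <- vbasis V, w <- vbasis W]>>%VS.

Lemma mulvP (V W X : {vspace A}) :
  reflect {in V & W, forall v w, mul v w \in X} (mulv V W <= X)%VS.
Proof.
apply: (iffP span_subvP) => [VWX v w vV wW | VWX _ /allpairsP[[v w] /= [vV wW ->]]].
  rewrite (coord_vbasis vV) (coord_vbasis wW) linear_sumlz rpred_sum // => i _.
  rewrite linearZl_LR rpredZ // linear_sumr rpred_sum // => j _.
  rewrite linearZr_LR rpredZ // VWX //; apply/allpairsP.
  by exists ((vbasis V)`_i, (vbasis W)`_j); rewrite !mem_nth ?size_tuple.
by rewrite VWX ?vbasis_mem.
Qed.

(* powers k lists A^0, A^1, ..., A^k; the term A^0, which plays no role, is
   set to A. *)
Fixpoint powers (k : nat) : seq {vspace A} :=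
  if k is k'.+1 then
    let s := powers k' in
    rcons s
      (if k' is 0 then fullv
       else (\sum_(1 <= j < k) mulv (nth fullv s j) (nth fullv s (k - j)))%VS)
  else [:: fullv].

Definition powv (k : nat) : {vspace A} := nth fullv (powers k) k.

Lemma size_powers k : size (powers k) = k.+1.
Proof. by elim: k => //= k IHk; rewrite size_rcons IHk. Qed.

Lemma nth_powers k j : (j <= k)%N -> nth fullv (powers k) j = powv j.
Proof.
elim: k => [|k IHk]; first by rewrite leqn0 => /eqP->.
rewrite leq_eqVlt ltnS => /predU1P[->//|jk].
by rewrite /= nth_rcons size_powers ltnS jk IHk.
Qed.

Lemma powv1 : powv 1 = fullv. Proof. by []. Qed.

Lemma powvS k : (0 < k)%N ->
  powv k.+1 = (\sum_(1 <= j < k.+1) mulv (powv j) (powv (k.+1 - j)))%VS.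
Proof.
case: k => // k _; rewrite {1}/powv [powers _]/= -/(powers k.+1).
rewrite nth_rcons size_powers ltnn eqxx; apply: eq_big_nat => j /andP[j0 jk].
by rewrite !nth_powers // leq_subLR -addn1 addnC leq_add2r.
Qed.

Definition nilpotent_alg : Prop := exists k, powv k = 0%VS.

Definition evolution_alg : Prop :=
  exists m (e : m.-tuple A), basis_of fullv e /\
    forall j k : 'I_m, j != k -> mul (tnth e j) (tnth e k) = 0.

(* The truncated subtraction is a genuine one by ann_seriesS. *)
Definition has_type (ns : seq nat) : Prop :=
  [/\ ann_series (size ns) = fullv,
      forall r, ann_series r = fullv -> (size ns <= r)%N &
      forall i, (i < size ns)%N ->
        nth 0%N ns i = (\dim (ann_series i.+1) - \dim (ann_series i))%N].

End Series.

Definition diagonalizable_end (F : fieldType) (U : vectType F) (f : 'End(U)) :=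
  exists m (e : m.-tuple U), basis_of fullv e /\
    forall i : 'I_m, exists a : F, f (tnth e i) = a *: tnth e i.

Section EvolutionConstruction.
Variables (F : fieldType) (U : vectType F) (b : {symmetric U}) (f g : 'End(U)).

Definition evo_space : vectType F := (U * F^o * F^o * F^o)%type.

Definition evo_mul (x y : evo_space) : evo_space :=
  let: (u, alpha, beta, gamma) := x in
  let: (v, epsilon, delta, eta) := y in
  (0, b u v, b (f u) v + alpha * epsilon, b (g u) v + beta * delta).

Fact evo_mul_bilinear : bilinear_for
  (GRing.Scale.Law.clone _ _ *:%R _) (GRing.Scale.Law.clone _ _ *:%R _) evo_mul.
Proof.
split=> [[[[u a] c] d] | [[[u a] c] d]] k [[[v a'] c'] d'] [[[w a''] c''] d''].
  do 3?congr pair => /=; rewrite ?scaler0 ?addr0 //.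
  - by rewrite linearPl.
  - by rewrite linearP linearPl /= mulrDl scalerDr -scalerAl addrACA.
  - by rewrite linearP linearPl /= mulrDl scalerDr -scalerAl addrACA.
do 3?congr pair => /=; rewrite ?scaler0 ?addr0 //.
- by rewrite linearPr.
- by rewrite linearPr /= mulrDr scalerDr -scalerAr addrACA.
- by rewrite linearPr /= mulrDr scalerDr -scalerAr addrACA.
Qed.

HB.instance Definition _ :=
  bilinear_isBilinear.Build F evo_space evo_space evo_space _ _ evo_mul evo_mul_bilinear.

Definition evo_alg : {bilinear evo_space -> evo_space -> evo_space} := evo_mul.

End EvolutionConstruction.

(* Main.v *)
From HB Require Import structures.
Require Import Defs.
From mathcomp Require Import zify.

(* Each vector of a subspace stable under f and g is a sum of common
   eigenvectors lying in that subspace, and common eigenvectors with different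
   eigenvalues are orthogonal; so in characteristic not 2 a nondegenerate stable
   subspace contains a nonisotropic common eigenvector v, and one splits off v
   and continues in its orthogonal complement.  This yields an orthogonal basis
   (u_i) of U of common eigenvectors, and the (u_i, 0, 0, 0) together with the
   unit vectors of the three copies of F form a natural basis.  By
   nondegeneracy, the annihilator series is
   0 x 0 x 0 x F, 0 x 0 x F x F, 0 x F x F x F, and then the whole algebra. *)

Set Implicit Arguments.
Unset Strict Implicit.

Import GRing.Theory.
Local Open Scope ring_scope.

(** * Nilpotency from an exhausting annihilator series *)

Section Powers.
Variables (F : fieldType) (A : vectType F) (mul : {bilinear A -> A -> A}).

(* In a product of at least [2 ^ i.+1] factors, however bracketed, one of the
   two outermost factors has at least [2 ^ i] factors. *)
Lemma powv_sub_ann_series r i k : ann_series mul r = fullv ->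
  (2 ^ i <= k)%N -> (powv mul k <= ann_series mul (r - i))%VS.
Proof.
move=> annr; elim: i k => [|i IHi] k ik; first by rewrite subn0 annr subvf.
(* For [r <= i] both truncated differences are 0, so the bound at [i] already suffices. *)
have [ri|ri] := leqP r i.
  rewrite (_ : r - i.+1 = r - i)%N; last lia.
  by apply: IHi; apply: leq_trans ik; rewrite leq_exp2l.
have lt1k : (1 < k)%N by apply: leq_trans ik; rewrite (leq_exp2l 1).
case: k lt1k ik => // k k1 ik; rewrite powvS; last lia.
rewrite big_seq; apply: (big_ind (fun X => X <= _)%VS) => [|X Y XA YA|j].
- exact: sub0v.
- by rewrite subv_add XA.
rewrite mem_index_iota => /andP[j0 jk]; apply/mulvP => v w vj wj.
have annS : ann_series mul (r - i) = ann_series mul (r - i.+1).+1.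
  by congr ann_series; lia.
have [ij|ji] := leqP (2 ^ i) j.
  have := subvP (IHi _ ij) _ vj; rewrite annS.
  by move=> /ann_seriesSP/(_ w)[].
have ikj : (2 ^ i <= k.+1 - j)%N by move: ik; rewrite expnS; lia.
have := subvP (IHi _ ikj) _ wj; rewrite annS.
by move=> /ann_seriesSP/(_ v)[].
Qed.

Lemma nilpotent_ann_series r : ann_series mul r = fullv -> nilpotent_alg mul.
Proof.
move=> annr; exists (2 ^ r)%N; apply/eqP; rewrite -subv0.
by have := @powv_sub_ann_series r r _ annr (leqnn _); rewrite subnn.
Qed.

End Powers.

(** * Orthogonal bases of common eigenvectors *)

Section CommonEigenvectors.
Variables (F : fieldType) (U : vectType F).

(** Applying [h - c] to the sum kills the component at [c] and scales each other [x a] by [a - c],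
    which is nonzero; induction on [s] then applies to the rescaled family. *)
Lemma eigen_component (h : 'End(U)) (V : {vspace U}) (s : seq F) (x : F -> U) :
  {in V, forall v, h v \in V} -> uniq s -> (forall a, h (x a) = a *: x a) ->
  \sum_(a <- s) x a \in V -> {in s, forall a, x a \in V}.
Proof.
move=> hV; elim: s x => [|c s IHs] // x /= /andP[cs us] xh xV.
have xsV : {in s, forall a, x a \in V}.
  move=> a sa; have ac : a - c != 0.
    by rewrite subr_eq0; apply: contraNneq cs => <-.
  suff : (a - c) *: x a \in V by rewrite rpredZeq (negPf ac).
  apply: (IHs (fun a => (a - c) *: x a)) => // [d|].
    by rewrite linearZ /= xh !scalerA mulrC.
  have -> : \sum_(d <- s) (d - c) *: x d =
      h (\sum_(d <- c :: s) x d) - c *: \sum_(d <- c :: s) x d.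
    rewrite linear_sum scaler_sumr -sumrB big_cons /= xh subrr add0r.
    by apply: eq_bigr => d _; rewrite /= xh scalerBl.
  by rewrite rpredB ?hV ?memvZ.
move=> a; rewrite inE => /predU1P[->|/xsV//].
move: xV; rewrite big_cons rpredDr //.
by rewrite big_seq rpred_sum.
Qed.

Variable b : {symmetric U}.

Lemma symmetricC u v : b u v = b v u.
Proof. by rewrite hermC mul1r. Qed.

(** The eigencomponents of [v] lie in [V], and their pairings with [w] add up to [b v w], so one of
    these is nonzero. *)
Lemma eigenvector_nonorthogonal (h : 'End(U)) (V : {vspace U}) v w :
  diagonalizable_end h -> {in V, forall v, h v \in V} ->
  v \in V -> b v w != 0 ->
  exists y, [/\ y \in V, b y w != 0 & exists a, h y = a *: y].
Proof.
case=> m [e [eB eh]] hV vV bvw.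
have {eh} [d dE] := fin_all_exists eh.
pose x a := \sum_(i | d i == a) coord e i v *: tnth e i.
have xh a : h (x a) = a *: x a.
  rewrite linear_sum scaler_sumr; apply: eq_bigr => i /eqP <-.
  by rewrite linearZ /= dE !scalerA mulrC.
(* Eigenvalues may repeat along the basis; [eigen_component] needs them distinct. *)
pose s := undup (codom d).
have vE : v = \sum_(a <- s) x a.
  rewrite {1}(coord_basis eB (memvf v)).
  rewrite (exchange_big_dep xpredT) //=; apply: eq_bigr => i _.
  rewrite -big_filter (eq_filter (a2 := pred1 (d i))) => [|a];
    last exact: eq_sym.
  rewrite filter_pred1_uniq ?undup_uniq ?mem_undup ?codom_f //.
  by rewrite big_seq1 (tnth_nth 0).
have /hasP[a sa bxw] : has (fun a => b (x a) w != 0) s.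
  apply: contraNT bvw => /hasPn bx0; rewrite vE linear_sumlz big_seq big1 //.
  by move=> a /bx0 /negPn /eqP.
exists (x a); split=> //; last by exists a.
by apply: (eigen_component hV _ xh _ sa); rewrite ?undup_uniq // -vE.
Qed.

Variables f g : 'End(U).
Hypothesis fgC : (f \o g = g \o f)%VF.
Hypotheses (f_diag : diagonalizable_end f) (g_diag : diagonalizable_end g).

Definition common_eigenvector (v : U) :=
  (exists a, f v = a *: v) /\ (exists a, g v = a *: v).

Lemma common_eigenvector_nonorthogonal (V : {vspace U}) v w :
  {in V, forall v, f v \in V} -> {in V, forall v, g v \in V} ->
  v \in V -> b v w != 0 ->
  exists y, [/\ y \in V, b y w != 0 & common_eigenvector y].
Proof.
move=> fV gV vV bvw.
have [y [yV byw [a fy]]] := eigenvector_nonorthogonal f_diag fV vV bvw.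
(* The eigenspace of [f] containing [y]. As [f] and [g] commute, [V :&: K] is stable under [g], so
   an eigenvector of [g] can be sought inside it. *)
pose K := lker (f - a *: \1%VF).
have memE x : (x \in K) = (f x == a *: x).
  by rewrite memv_ker add_lfunE opp_lfunE scale_lfunE id_lfunE subr_eq0.
have gVa : {in (V :&: K)%VS,
    forall x, g x \in (V :&: K)%VS}.
  move=> x; rewrite !memv_cap !memE => /andP[xV /eqP fx].
  by rewrite gV //= -comp_lfunE fgC comp_lfunE /= fx linearZ.
have yVa : y \in (V :&: K)%VS by rewrite memv_cap yV memE fy /=.
have [z []] := eigenvector_nonorthogonal g_diag gVa yVa byw.
rewrite memv_cap memE => /andP[zV /eqP fz] bzw gz.
by exists z; split=> //; split=> //; exists a.
Qed.

Hypothesis f_sym : forall u v, b (f u) v = b u (f v).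
Hypothesis g_sym : forall u v, b (g u) v = b u (g v).

Lemma symmetric_eigenvalue_eq (h : 'End(U)) u v a c :
  (forall u v, b (h u) v = b u (h v)) -> h u = a *: u -> h v = c *: v ->
  b u v != 0 -> a = c.
Proof.
move=> h_sym hu hv buv; apply: (mulIf buv).
have <- : b (a *: u) v = a * b u v by rewrite linearZl_LR.
by rewrite -hu h_sym hv linearZr_LR.
Qed.

Hypothesis charF_neq2 : 2%N \notin [pchar F].

(** Replacing first [v], then [w], gives common eigenvectors [y], [z] with [b z y != 0]. If both are
    isotropic, their eigenvalues agree, so [z + y] is a common eigenvector, of norm [2 * b z y]. *)
Lemma nonisotropic_common_eigenvector (V : {vspace U}) v w :
  {in V, forall v, f v \in V} -> {in V, forall v, g v \in V} ->
  v \in V -> w \in V -> b v w != 0 ->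
  exists y, [/\ y \in V, b y y != 0 & common_eigenvector y].
Proof.
move=> fV gV vV wV bvw.
have [y [yV]] := common_eigenvector_nonorthogonal fV gV vV bvw.
rewrite symmetricC => bwy y_eig.
have [z [zV bzy z_eig]] := common_eigenvector_nonorthogonal fV gV wV bwy.
have [byy|byy] := eqVneq (b y y) 0; last by exists y.
have [bzz|bzz] := eqVneq (b z z) 0; last by exists z.
case: y_eig z_eig => [[a fy] [a' gy]] [[c fz] [c' gz]].
exists (z + y); split; first exact: rpredD.
  rewrite linearDl /= !linearDr /= byy bzz addr0 add0r (symmetricC y z) -mulr2n.
  by rewrite -mulr_natl mulf_neq0 // -[_%:R == 0]/(2 \in [pchar F]).
have eca := symmetric_eigenvalue_eq f_sym fz fy bzy.
have eca' := symmetric_eigenvalue_eq g_sym gz gy bzy.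
by split; [exists a | exists a'];
  rewrite linearD /= ?(fy, gy) ?(fz, gz) ?(eca, eca') scalerDr.
Qed.

Lemma orthogonal_eigenbasis (V : {vspace U}) :
  {in V, forall v, f v \in V} -> {in V, forall v, g v \in V} ->
  {in V, forall v : U, v != 0 -> exists2 w, w \in V & b v w != 0} ->
  exists s : seq U, [/\ basis_of V s, pairwise (fun u v => b u v == 0) s &
    {in s, forall v, common_eigenvector v}].
Proof.
have [n] := ubnP (\dim V); elim: n V => // n IHn V dimV fV gV ndV.
have [V0|] := eqVneq V 0%VS.
  by exists [::]; split=> //; rewrite V0 nil_basis.
rewrite -vpick0 => v0.
have [w wV bvw] := ndV _ (memv_pick V) v0.
have [y [yV byy y_eig]] :=
  nonisotropic_common_eigenvector fV gV (memv_pick V) wV bvw.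
pose W := (V :&: orthov b <[y]>)%VS.
have memW x : (x \in W) = (x \in V) && (b x y == 0).
  by rewrite memv_cap mem_orthov1.
(* The projection along [y] onto its orthogonal complement. *)
pose p x := x - (b x y / b y y) *: y.
have pW x : x \in V -> p x \in W.
  move=> xV; rewrite memW rpredB ?memvZ //= linearBl /= linearZl_LR /=.
  by rewrite divfK // subrr.
have dimW : (\dim W < \dim V)%N.
  rewrite ltn_neqAle dimvS ?capvSl // andbT.
  apply: contraNneq byy => dimWV.
  have /eqP WV : (W == V)%VS by rewrite eqEdim capvSl dimWV /=.
  by move: yV; rewrite -WV memW => /andP[].
have stableW (h : 'End(U)) : (forall u v, b (h u) v = b u (h v)) ->
    {in V, forall v, h v \in V} -> (exists a, h y = a *: y) ->
    {in W, forall x, h x \in W}.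
  move=> h_sym hV [a hy] x; rewrite !memW => /andP[xV /eqP bxy].
  by rewrite hV //= h_sym hy linearZr_LR /= bxy mulr0.
have [||||s [sB s_orth s_eig]] := IHn W.
- exact: leq_trans dimW _.
- by apply: stableW => //; case: y_eig.
- by apply: stableW => //; case: y_eig.
- move=> x; rewrite memW => /andP[xV /eqP bxy] x0.
  have [z zV bxz] := ndV x xV x0.
  (* Nondegeneracy passes to [W]: [x] is orthogonal to [y], hence [b x (p z) = b x z]. *)
  by exists (p z); rewrite ?pW // linearBr /= linearZr_LR /= bxy mulr0 subr0.
exists (y :: s); split=> /=.
- rewrite basisEdim /= -(size_basis (X := in_tuple s) sB) dimW andbT.
  rewrite span_cons (span_basis sB); apply/subvP => x xV.
  rewrite -(subrK ((b x y / b y y) *: y) x) addrC.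
  by rewrite memv_add ?memvZ ?memv_line ?pW.
- rewrite s_orth andbT; apply/allP => x /(basis_mem sB).
  by rewrite memW symmetricC => /andP[].
- by move=> x; rewrite inE => /predU1P[->|/s_eig].
Qed.

End CommonEigenvectors.

(** * Natural basis and annihilator series of the constructed algebra *)

Section EvolutionConstruction.
Variables (F : fieldType) (U : vectType F) (b : {symmetric U}) (f g : 'End(U)).
Local Notation E := (evo_space U).
Local Notation mul := (evo_alg b f g).

Definition evo_inj (u : U) : E := (u, 0, 0, 0).
(** The last coordinate comes first, so that for [i <= 3] the first [i] vectors span the [i]-th term
    of the annihilator series. *)
Definition evo_units : seq E := [:: (0, 0, 0, 1); (0, 0, 1, 0); (0, 1, 0, 0)].

Lemma evo_mulE (u v : U) (a c d a' c' d' : F^o) :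
  mul (u, a, c, d) (v, a', c', d') =
  (0, b u v, b (f u) v + a * a', b (g u) v + c * c').
Proof. by []. Qed.

Lemma dim_evo_space : \dim {:E} = (\dim {:U} + 3)%N.
Proof. by rewrite !dimvf -[3%N]/(1 + 1 + 1)%N !addnA. Qed.

Lemma evo_inj_is_linear : linear evo_inj.
Proof.
by move=> a u v; do 3?congr pair => /=; rewrite ?scaler0 ?addr0.
Qed.
HB.instance Definition _ :=
  GRing.isLinear.Build F U E _ evo_inj evo_inj_is_linear.

Lemma evo_basis (s : seq U) : basis_of fullv s ->
  basis_of fullv (evo_units ++ map evo_inj s).
Proof.
move=> sB; rewrite basisEdim dim_evo_space size_cat size_map addnC.
rewrite (size_basis (X := in_tuple s) sB) leqnn andbT.
apply/subvP => -[[[u a] c] d] _.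
have -> : (u, a, c, d) = d *: (0, 0, 0, 1) + c *: (0, 0, 1, 0) +
    a *: (0, 1, 0, 0) + evo_inj u :> E.
  by do 3?congr pair => /=; rewrite ?scaler0 ?addr0 ?add0r // [_ *: _]mulr1.
have us : evo_inj u \in <<map evo_inj s>>%VS.
  have : u \in <<s>>%VS by rewrite (span_basis sB) memvf.
  move=> /(memv_img (linfun evo_inj)); rewrite lfunE limg_span.
  by congr (_ \in <<_>>%VS); apply: eq_map => x; rewrite lfunE.
rewrite span_cat memv_add // !rpredD // memvZ //;
  by rewrite memv_span // !inE eqxx ?orbT.
Qed.

Hypothesis b_nondegenerate : nondegenerate b.
Hypothesis f_sym : forall u v, b (f u) v = b u (f v).
Hypothesis g_sym : forall u v, b (g u) v = b u (g v).

Lemma nondegenerate_eq0 u : (forall v, b u v = 0) -> u = 0.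
Proof.
move=> bu0; apply/eqP; rewrite -memv0 -(eqP b_nondegenerate).
by apply/mem_orthovP => v _; apply: bu0.
Qed.

Lemma evo_mulC x y : mul x y = mul y x.
Proof.
case: x y => [[[u a] c] d] [[[v a'] c'] d'].
rewrite !evo_mulE f_sym g_sym (symmetricC b u v).
by rewrite (symmetricC b u (f v)) (symmetricC b u (g v)) (mulrC a) (mulrC c).
Qed.

Lemma mem_evo_ann_series i (u : U) (a c d : F^o) : (i <= 3)%N ->
  reflect
    [/\ u = 0, (i < 3)%N -> a = 0, (i < 2)%N -> c = 0 & (i < 1)%N -> d = 0]
    (((u, a, c, d) : E) \in ann_series mul i).
Proof.
elim: i u a c d => [|i IHi] u a c d i3.
  rewrite memv0; apply: (iffP eqP) => [[-> -> -> ->]//|].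
  by case=> -> -> // -> // -> //.
have {}IHi u' a' c' d' := IHi u' a' c' d' (ltnW i3).
apply: (iffP (ann_seriesSP _ _ _)) => [xA|[-> a0 c0 _] [[[v a'] c'] d']].
  split=> // [|i2|i1].
  (* The second coordinate of the product with [(v, 0, 0, 0)] is [b u v], which must vanish since
     [i < 3]. *)
  - apply: nondegenerate_eq0 => v.
    by have [/(IHi _ _ _ _)[_ -> //]] := xA (v, 0, 0, 0).
  (* Multiplying by this unit moves [a] to the third coordinate; the next unit likewise moves [c] to
     the fourth. *)
  - have [/(IHi _ _ _ _)[_ _ + _] _] := xA (0, 1, 0, 0).
    by rewrite linear0r add0r mulr1; apply.
  - have [/(IHi _ _ _ _)[_ _ _ +] _] := xA (0, 0, 1, 0).
    by rewrite linear0r add0r mulr1; apply.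
rewrite -(evo_mulC (0, a, c, d)).
suff: mul (0, a, c, d) (v, a', c', d') \in ann_series mul i by [].
rewrite evo_mulE !linear0 !linear0l !add0r.
by apply/IHi; split=> // [i2|i1]; rewrite ?a0 ?c0 ?mul0r.
Qed.

(* Unfolding the iterated quotients makes conversion problems blow up. *)
Local Opaque ann_series.

Lemma evo_ann_seriesE i : (i <= 3)%N ->
  ann_series mul i = <<take i evo_units>>%VS.
Proof.
move=> i3; apply/eqP; rewrite eqEsubv; apply/andP; split; last first.
  apply/span_subvP => x.
  case: i i3 => [|[|[|[|//]]]] i3 /=; rewrite ?inE //.
  - by move=> /eqP->; apply/(mem_evo_ann_series _ _ _ _ i3).
  - by case/orP => /eqP->; apply/(mem_evo_ann_series _ _ _ _ i3).
  - by case/or3P => /eqP->; apply/(mem_evo_ann_series _ _ _ _ i3).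
apply/subvP => -[[[u a] c] d] xA.
have [-> a0 c0 d0] := elimT (mem_evo_ann_series u a c d i3) xA.
have -> : (0, a, c, d) = d *: (0, 0, 0, 1) + c *: (0, 0, 1, 0) +
    a *: (0, 1, 0, 0) :> E.
  by do 3?congr pair => /=; rewrite ?scaler0 ?addr0 ?add0r // [_ *: _]mulr1.
case: i i3 a0 c0 d0 {xA} => [|[|[|[|//]]]] i3 a0 c0 d0.
- by rewrite a0 // c0 // d0 // !scale0r !addr0 mem0v.
- by rewrite a0 // c0 // !scale0r !addr0 memvZ // memv_span // inE.
- rewrite a0 // scale0r addr0 rpredD // memvZ // memv_span //;
    by rewrite !inE eqxx ?orbT.
- by rewrite !rpredD // memvZ // memv_span // !inE eqxx ?orbT.
Qed.

Lemma dim_evo_ann_series i : (i <= 3)%N -> \dim (ann_series mul i) = i.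
Proof.
move=> i3; have /basis_free := evo_basis (vbasisP fullv).
move=> /catl_free; rewrite -(cat_take_drop i evo_units) => /catl_free/eqP.
by rewrite -evo_ann_seriesE // size_takel.
Qed.

(** Every product has zero component in [U], which is the only condition for lying in the third
    term. *)
Lemma evo_ann_series4 : ann_series mul 4 = fullv.
Proof.
apply/vspaceP => -[[[u a] c] d]; rewrite memvf.
apply/(@ann_seriesSP _ _ mul 3) => -[[[v a'] c'] d'].
by split; apply/(mem_evo_ann_series _ _ _ _ (leqnn 3)).
Qed.

End EvolutionConstruction.

Theorem proposition4p6 (F : fieldType) (charF_neq2 : 2%N \notin [pchar F])
  (U : vectType F) (n : nat) (dimU : \dim {:U} = n) (n_gt0 : (0 < n)%N)
  (b : {symmetric U}) (b_nondegenerate : nondegenerate b)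
  (f g : 'End(U)) (fgC : (f \o g = g \o f)%VF)
  (f_diagonalizable : diagonalizable_end f)
  (g_diagonalizable : diagonalizable_end g)
  (f_symmetric : forall u v, b (f u) v = b u (f v))
  (g_symmetric : forall u v, b (g u) v = b u (g v)) :
  [/\ nilpotent_alg (evo_alg b f g),
      evolution_alg (evo_alg b f g) &
      has_type (evo_alg b f g) [:: 1; 1; 1; n]%N].
Proof.
have ann4 := evo_ann_series4 b_nondegenerate f_symmetric g_symmetric.
have dim_ann := dim_evo_ann_series b_nondegenerate f_symmetric g_symmetric.
split; first exact: nilpotent_ann_series ann4.
  have [||v _ v0|s [sB s_orth s_eig]] := orthogonal_eigenbasis fgC
      f_diagonalizable g_diagonalizable f_symmetric g_symmetric charF_neq2
      (V := fullv).
  - by move=> v _; apply: memvf.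
  - by move=> v _; apply: memvf.
  - have /mem_orthovPn[w wV bvw] : v \notin orthov b fullv.
      by rewrite (eqP b_nondegenerate) memv0.
    by exists w.
  pose e := evo_units U ++ map (@evo_inj F U) s.
  have mul_orth : pairwise (fun x y => evo_alg b f g x y == 0) e.
    rewrite pairwise_cat pairwise_map; apply/and3P; split.
    + apply/allrelP => x _ + /mapP[v _ ->].
      rewrite !inE => /or3P[] /eqP->;
        by rewrite evo_mulE !linear0 !linear0l !mulr0 !addr0.
    + by rewrite /= !linear0r !(mulr0, mul0r) !addr0 !eqxx.
    (* For eigenvectors, [b (f u) v] and [b (g u) v] are multiples of [b u v = 0]. *)
    + apply: (sub_in_pairwise (P := mem s)) s_orth => [u v us vs /= /eqP buv|].
        have [[a fu] [a' gu]] := s_eig u us.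
        by rewrite fu gu !linearZl_LR /= buv !mulr0 !addr0.
      by apply/allP.
  exists _, (in_tuple e); split; first exact: evo_basis.
  have mul0 j k : (j < k)%N -> (k < size e)%N -> evo_alg b f g e`_j e`_k = 0.
    move=> jk ks; apply/eqP; move: mul_orth => /(pairwiseP 0); apply=> //.
    exact: ltn_trans ks.
  move=> j k; rewrite !(tnth_nth 0) neq_ltn => /orP[jk|kj]; first exact: mul0.
  by rewrite evo_mulC //; apply: mul0.
split=> // [r annr|[|[|[|[|//]]]] _]; last 4 first.
- by rewrite !dim_ann.
- by rewrite !dim_ann.
- by rewrite !dim_ann.
- by rewrite ann4 dim_evo_space dimU dim_ann // addnK.
(* If [r < 4], the whole algebra would have dimension [r <= 3], whereas [n + 3 > 3] because
   [n > 0]. *)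
rewrite leqNgt; apply/negP => r3; have := dim_ann r r3.
by rewrite annr dim_evo_space dimU; move: r3 => /=; lia.
Qed.
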